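(* Let $H$ be a digraph with vertex set $V(H)=\{1,\dots,n\}$ (loops allowed, no multiple arcs). Let $T$ be an $n$-partitioned graph and suppose that $T\cong T_1\circ_H T_2\circ_H\cdots\circ_H T_k$ and $T\cong R_1\circ_H R_2\circ_H\cdots\circ_H R_l$, where $k,l\ge 1$ and all $T_i$ and $R_j$ are $H$-prime $n$-partitioned graphs. Then $k=l$, and the sequence $(R_1,\dots,R_k)$ can be obtained, up to isomorphism of the individual factors, from the sequence $(T_1,\dots,T_k)$ by finitely many interchanges of two consecutive factors $P,Q$ satisfying $P\circ_H Q\cong Q\circ_H P$. (That is, the $H$-decomposition of every $n$-partitioned graph is unique up to permutation of standing-together commuting factors.)
   Context: All graphs are finite, simple and undirected; digraphs may have loops but no multiple arcs. An $n$-partitioned graph is a tuple $T=(G,A_1,\dots,A_n)$ where $G$ is a graph and $(A_1,\dots,A_n)$ is a partition of $V(G)$ into pairwise disjoint sets, some of which may be empty. Two $n$-partitioned graphs $(G,A_1,\dots,A_n)$ and $(F,B_1,\dots,B_n)$ are isomorphic if there is a graph isomorphism $f:G\to F$ with $f(A_i)=B_i$ for all $i$; $n$-partitioned graphs are considered up to this isomorphism. For a digraph $H$ on $\{1,\dots,n\}$, the $H$-product of $(G,A_1,\dots,A_n)$ and $(F,B_1,\dots,B_n)$ (with $V(G)\cap V(F)=\emptyset$) is $(R,A_1\cup B_1,\dots,A_n\cup B_n)$, where $V(R)=V(G)\cup V(F)$ and $E(R)=E(G)\cup E(F)\cup\{xy: x\in A_i,\ y\in B_j,\ (i,j)\in A(H)\}$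 (here $(i,i)$ may be a loop of $H$). This operation is associative. An $n$-partitioned graph $T$ is $H$-decomposable if $T\cong T_1\circ_H T_2$ for $n$-partitioned graphs $T_1,T_2$ with nonempty vertex sets, and $H$-prime otherwise.
   Formalization: H-prime n-partitioned graphs are required to have a nonempty vertex set; read literally, the empty graph would be H-prime and, being a unit for the H-product, would make k=l false. *)

(* Defs.v *)
From mathcomp Require Import all_boot.
From Stdlib Require List Relations.Relation_Operators.

Set Implicit Arguments.
Unset Strict Implicit.
Unset Printing Implicit Defensive.

Record pgraph (n : nat) := PGraph {
  vert : finType;
  edge : rel vert;
  block : 'I_n -> {set vert};
  edge_sym : symmetric edge;
  edge_irr : irreflexive edge;
  block_disj : forall i j, i != j -> [disjoint block i & block j];
  block_cover : \bigcup_(i < n) block i = [set: vert]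
}.

Definition pgraph_iso n (G F : pgraph n) : Prop :=
  exists f : vert G -> vert F,
    [/\ bijective f,
        forall x y, edge (f x) (f y) = edge x y
      & forall i, f @: block G i = block F i].

Section Product.
Variables (n : nat) (H : rel 'I_n) (G F : pgraph n).

Definition cross (x : vert G) (y : vert F) : bool :=
  [exists i, exists j, [&& x \in block G i, y \in block F j & H i j]].

(* The disjoint union of the two vertex sets is the sum type, so the vertex
   sets of the factors need not be assumed disjoint. *)
Definition hprod_edge : rel (vert G + vert F) := fun u v =>
  match u, v with
  | inl x, inl x' => edge x x'
  | inr y, inr y' => edge y y'
  | inl x, inr y => cross x y
  | inr y, inl x => cross x y
  end.

Definition hprod_block (i : 'I_n) : {set vert G + vert F} :=
  (inl @: block G i) :|: (inr @: block F i).

Lemma hprod_edge_sym : symmetric hprod_edge.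
Proof. by move=> [x|x] [y|y] //=; apply: edge_sym. Qed.

Lemma hprod_edge_irr : irreflexive hprod_edge.
Proof. by move=> [x|x] /=; apply: edge_irr. Qed.

Lemma in_hprod_block i u :
  (u \in hprod_block i) =
  match u with inl x => x \in block G i | inr y => y \in block F i end.
Proof.
have injl : injective (@inl (vert G) (vert F)) by move=> ? ? [].
have injr : injective (@inr (vert G) (vert F)) by move=> ? ? [].
rewrite inE; case: u => x; rewrite mem_imset //.
  by rewrite orbC; case: imsetP => [[]|].
by case: imsetP => [[]|].
Qed.

Lemma hprod_block_disj i j :
  i != j -> [disjoint hprod_block i & hprod_block j].
Proof.
move=> ij; rewrite disjoint_subset; apply/subsetP => u.
rewrite !inE -!in_setU -!/(hprod_block _) !in_hprod_block.
by case: u => x xi; rewrite (disjointFr (block_disj _ ij)).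
Qed.

Lemma hprod_block_cover : \bigcup_(i < n) hprod_block i = [set: vert G + vert F].
Proof.
apply/setP => u; rewrite inE; apply/bigcupP.
case: u => x.
  have : x \in \bigcup_(i < n) block G i by rewrite block_cover inE.
  by case/bigcupP => i _ xi; exists i; rewrite ?in_hprod_block.
have : x \in \bigcup_(i < n) block F i by rewrite block_cover inE.
by case/bigcupP => i _ xi; exists i; rewrite ?in_hprod_block.
Qed.

Definition hprod : pgraph n :=
  PGraph hprod_edge_sym hprod_edge_irr hprod_block_disj hprod_block_cover.

End Product.

(* P o_H s_1 o_H ... o_H s_m, bracketed to the left. *)
Definition hprods n (H : rel 'I_n) (P : pgraph n) (s : seq (pgraph n)) :
  pgraph n := foldl (hprod H) P s.

Definition h_decomposable n (H : rel 'I_n) (T : pgraph n) : Prop :=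
  exists T1 T2 : pgraph n,
    [/\ 0 < #|vert T1|, 0 < #|vert T2| & pgraph_iso T (hprod H T1 T2)].

(* The graph with no vertices is a unit for hprod; it is not prime, since
   otherwise it could be inserted as a factor anywhere and the number of prime
   factors would not be determined. *)
Definition h_prime n (H : rel 'I_n) (T : pgraph n) : Prop :=
  0 < #|vert T| /\ ~ h_decomposable H T.

Inductive commuting_swap n (H : rel 'I_n) :
  seq (pgraph n) -> seq (pgraph n) -> Prop :=
| CommutingSwap s1 s2 P Q :
    pgraph_iso (hprod H P Q) (hprod H Q P) ->
    commuting_swap H (s1 ++ P :: Q :: s2) (s1 ++ Q :: P :: s2).

Definition commuting_swaps n (H : rel 'I_n) :
  seq (pgraph n) -> seq (pgraph n) -> Prop :=
  Relation_Operators.clos_refl_trans _ (@commuting_swap n H).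

(* Main.v *)
(** Let [c x] be the part containing the vertex [x] of [T]. Call a set [A] of
    vertices a lower part of [T] if every [x] in [A] and [y] outside [A] satisfy
    [edge x y <-> H (c x) (c y)]. A factorization of [T] into primes cuts the
    vertices into consecutive pieces whose initial unions are lower parts, and
    no piece can be split further. Hence a piece of one factorization never
    straddles an initial union of another one, so two pieces that meet coincide:
    both factorizations have the same pieces (the strong components of the
    digraph of the pairs with [edge x y <> H (c x) (c y)]), in two linear orders.
    Moving the first piece of one order to the front of the other only passes
    over pieces standing on either side of it in the two orders, and such pieces
    commute. *)
Require Import Defs.
From mathcomp Require Import all_boot.
From Stdlib Require List.

Set Implicit Arguments.
Unset Strict Implicit.
Unset Printing Implicit Defensive.

(** * Embeddings and induced partitioned graphs *)

Section Embedding.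
Variable n : nat.
Implicit Types G F T : pgraph n.

Definition embedding G T (f : vert G -> vert T) : Prop :=
  [/\ injective f, {mono f : x y / edge x y}
    & forall i x, (f x \in block T i) = (x \in block G i)].

Lemma embedding_comp G F T (f : vert F -> vert T) (g : vert G -> vert F) :
  embedding f -> embedding g -> embedding (f \o g).
Proof.
move=> [fI fE fB] [gI gE gB]; split=> [|x y|i x] /=; first exact: inj_comp.
  by rewrite fE gE.
by rewrite fB gB.
Qed.

Lemma embedding_iso G T (f : vert G -> vert T) :
  embedding f -> bijective f -> pgraph_iso G T.
Proof.
move=> [fI fE fB] fbij; exists f; split=> // i; apply/setP => y.
case: fbij => g fK gK; rewrite -[y]gK mem_imset // fB //.
Qed.

Lemma iso_embedding G T :
  pgraph_iso G T -> exists2 f : vert G -> vert T, embedding f & bijective f.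
Proof.
move=> [f [fbij fE fB]]; have fI := bij_inj fbij.
by exists f => //; split=> // i x; rewrite -fB mem_imset.
Qed.

Lemma pgraph_iso_sym G T : pgraph_iso G T -> pgraph_iso T G.
Proof.
case/iso_embedding => f [fI fE fB] [g fK gK].
apply: (@embedding_iso _ _ g); last by exists f.
split=> [|x y|i x]; first exact: can_inj gK.
  by rewrite -fE !gK.
by rewrite -fB gK.
Qed.

(** The set [S], with the structure inherited from [T], is a copy of [G]. Using an embedding instead
    of an isomorphism onto [induced S] keeps subtypes out of the later arguments. *)
Definition realizes T (S : {set vert T}) G : Prop :=
  exists2 f : vert G -> vert T, embedding f & S = f @: [set: vert G].

Lemma realizes_iso T (S : {set vert T}) G F :
  realizes S G -> realizes S F -> pgraph_iso G F.
Proof.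
move=> [f [fI fE fB] Sf] [g [gI gE gB] Sg].
(* The two embeddings have the same image, so each vertex of one graph is matched with the vertex of
   the other that has the same image in [T]. *)
have ex_h x : exists y, g y == f x.
  have: f x \in S by rewrite Sf imset_f.
  by rewrite Sg => /imsetP[y _ ->]; exists y.
have ex_k y : exists x, f x == g y.
  have: g y \in S by rewrite Sg imset_f.
  by rewrite Sf => /imsetP[x _ ->]; exists x.
pose h x := xchoose (ex_h x); pose k y := xchoose (ex_k y).
have gh x : g (h x) = f x by apply/eqP/(xchooseP (ex_h x)).
have fk y : f (k y) = g y by apply/eqP/(xchooseP (ex_k y)).
apply: (@embedding_iso _ _ h).
  split=> [x y e|x y|i x]; first by apply: fI; rewrite -!gh e.
    by rewrite -gE !gh fE.
  by rewrite -gB gh fB.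
by exists k => [x|y]; [apply: fI; rewrite fk gh | apply: gI; rewrite gh fk].
Qed.

Section Induced.
Variables (G : pgraph n) (A : {set vert G}).

Definition induced_edge : rel {x | x \in A} := fun x y => edge (val x) (val y).

Definition induced_block i : {set {x | x \in A}} := [set x | val x \in block G i].

Lemma induced_edge_sym : symmetric induced_edge.
Proof. by move=> x y; apply: edge_sym. Qed.

Lemma induced_edge_irr : irreflexive induced_edge.
Proof. by move=> x; apply: edge_irr. Qed.

Lemma induced_block_disj i j :
  i != j -> [disjoint induced_block i & induced_block j].
Proof.
move=> ij; rewrite disjoint_subset; apply/subsetP => x.
by rewrite !inE => xi; rewrite (disjointFr (block_disj _ ij)).
Qed.

Lemma induced_block_cover :
  \bigcup_(i < n) induced_block i = [set: {x | x \in A}].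
Proof.
apply/setP => x; rewrite inE; apply/bigcupP.
have : val x \in \bigcup_(i < n) block G i by rewrite block_cover inE.
by case/bigcupP => i _ xi; exists i; rewrite ?inE.
Qed.

Definition induced : pgraph n :=
  PGraph induced_edge_sym induced_edge_irr induced_block_disj
         induced_block_cover.

End Induced.

End Embedding.

(** * Cuts, atomic sets and their uniqueness *)

Section Factorization.
Variables (n : nat) (H : rel 'I_n).
Implicit Types G F T : pgraph n.

Lemma embedding_cross G F T (f : vert G -> vert T) (g : vert F -> vert T) x y :
  embedding f -> embedding g -> cross H (f x) (g y) = cross H x y.
Proof.
move=> [_ _ fB] [_ _ gB]; apply: eq_existsb => i; apply: eq_existsb => j.
by rewrite fB gB.
Qed.

Lemma embedding_inl G F : @embedding n G (hprod H G F) inl.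
Proof. by split=> [x y []|x y|i x] //; rewrite in_hprod_block. Qed.

Lemma embedding_inr G F : @embedding n F (hprod H G F) inr.
Proof. by split=> [x y []|x y|i x] //; rewrite in_hprod_block. Qed.

Section Pieces.
Variable T : pgraph n.
Implicit Types (A B S U : {set vert T}) (s u : seq {set vert T}).

(* With both vertices in [T], [cross H x y] is [H (c x) (c y)]. *)
Definition cut A B : bool :=
  [forall x in A, forall y in B, edge x y == cross H x y].

Lemma cutP A B :
  reflect {in A & B, forall x y, edge x y = cross H x y} (cut A B).
Proof.
apply: (iffP forall_inP) => [AB x y xA yB|AB x xA].
  by apply/eqP; apply: (forall_inP (AB x xA)).
by apply/forall_inP => y yB; apply/eqP/AB.
Qed.

(** This is strong connectedness of [S] in the digraph of the pairs with [edge x y != cross H x y].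
    Letting [A] range over subsets of [T], not of [S], allows testing [S] directly against the
    members of another family. *)
Definition atomic S : bool :=
  (S != set0) &&
  [forall A : {set vert T},
    cut (S :&: A) (S :\: A) ==> (S \subset A) || [disjoint S & A]].

Definition precedes A B : bool := [disjoint A & B] && cut A B.

Lemma bigcup_seqP x s :
  reflect (exists2 A, A \in s & x \in A) (x \in \bigcup_(A <- s) A).
Proof. by rewrite bigcup_seq; apply: bigcupP. Qed.

(** Induction on [u]. What [S] has outside the first member [W] is covered by later members, so [W]
    cuts [S]; by atomicity [S] lies inside [W] or misses it. In the second case the tail still
    covers [S]. *)
Lemma atomic_sub S U u :
  atomic S -> pairwise precedes u -> S \subset \bigcup_(A <- u) A ->
  U \in u -> ~~ [disjoint S & U] -> S \subset U.
Proof.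
move=> /andP[_ /forallP Sat]; elim: u => [|W u IH] //=.
rewrite big_cons => /andP[/allP Wu uu] SWu Uu SU.
have disjW : U \in u -> [disjoint W & U] by move/Wu => /andP[].
have /orP[SW|SW] : (S \subset W) || [disjoint S & W].
  apply: (implyP (Sat W)); apply/cutP => x y.
  rewrite inE => /andP[xS xW]; rewrite inE => /andP[yW yS].
  have := subsetP SWu y yS; rewrite inE (negPf yW) /= => /bigcup_seqP[B Bu yB].
  by have /andP[_ /cutP] := Wu B Bu; apply.
- move: Uu; rewrite inE => /orP[/eqP -> //|Uu].
  by case/negP: SU; apply: disjointWl SW (disjW Uu).
- move: Uu; rewrite inE => /orP[/eqP UW|Uu]; first by rewrite UW SW in SU.
  apply: IH => //; apply/subsetP => x xS.
  by have := subsetP SWu x xS; rewrite inE (disjointFr SW xS).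
Qed.

Lemma atomic_uniq s : all atomic s -> pairwise precedes s -> uniq s.
Proof.
elim: s => [|S s IH] //= /andP[/andP[S0 _] sat] /andP[/allP Ss ss].
rewrite IH // andbT; apply/negP => /Ss /andP[].
by rewrite -setI_eq0 setIid (negPf S0).
Qed.

Lemma atomic_perm_eq s u :
  all atomic s -> pairwise precedes s -> \bigcup_(A <- s) A = [set: vert T] ->
  all atomic u -> pairwise precedes u -> \bigcup_(A <- u) A = [set: vert T] ->
  perm_eq s u.
Proof.
have sub v w : all atomic v -> pairwise precedes v ->
    \bigcup_(A <- v) A = [set: vert T] ->
    all atomic w -> pairwise precedes w ->
    \bigcup_(A <- w) A = [set: vert T] -> {subset v <= w}.
  move=> /allP vat vv vT /allP wat ww wT S Sv.
  have /andP[/set0Pn[x xS] _] := vat S Sv.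
  have : x \in \bigcup_(A <- w) A by rewrite wT inE.
  case/bigcup_seqP => U Uw xU.
  have SU : ~~ [disjoint S & U].
    by apply/negP => /disjointFr/(_ xS); rewrite xU.
  (* Both sets are atomic and they share [x], so [atomic_sub] gives each inclusion. *)
  suff -> : S = U by [].
  apply/eqP; rewrite eqEsubset.
  rewrite (atomic_sub (vat S Sv) ww) ?wT ?subsetT //.
  by rewrite (atomic_sub (wat U Uw) vv) ?vT ?subsetT // disjoint_sym.
move=> sat ss sT uat uu uT.
apply: uniq_perm; rewrite ?atomic_uniq // => S.
by apply/idP/idP; apply: sub.
Qed.

(** A set [A] that cuts [S] properly pulls back to a vertex set [B] of [G], and [G] is then the
    product of the subgraphs induced on [B] and on its complement, against primality. *)
Lemma prime_atomic S G : h_prime H G -> realizes S G -> atomic S.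
Proof.
move=> [G0 Gprime] [f femb ->]; have [fI fE fB] := femb.
apply/andP; split.
  by have /card_gt0P[x _] := G0; apply/set0Pn; exists (f x); rewrite imset_f.
apply/forallP => A; apply/implyP => /cutP cutA.
apply/negPn/negP; rewrite negb_or => /andP[/subsetPn[_ /imsetP[y _ ->] yA]].
rewrite -setI_eq0 => /set0Pn[_ /setIP[/imsetP[x _ ->] xA]].
pose B := f @^-1: A; apply: Gprime; exists (induced B), (induced (~: B)).
have xB : x \in B by rewrite inE.
have yB : y \in ~: B by rewrite !inE.
split; first by apply/card_gt0P; exists (Sub x xB).
  by apply/card_gt0P; exists (Sub y yB).
apply: pgraph_iso_sym.
pose g (u : vert (hprod H (induced B) (induced (~: B)))) : vert G :=
  match u with inl z => val z | inr z => val z end.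
have gE (a : vert (induced B)) (b : vert (induced (~: B))) :
    edge (val a) (val b) = cross H a b.
  have aB := valP a; have bB := valP b; rewrite !inE in aB bB.
  rewrite -fE cutA ?inE ?aB ?bB ?imset_f //.
  rewrite (embedding_cross _ _ femb femb).
  by apply: eq_existsb => i; apply: eq_existsb => j; rewrite !inE.
have gemb : embedding g.
  split.
  - move=> [a|a] [b|b] /= e; first by rewrite (val_inj e).
    + by have := valP b; rewrite in_setC /= -e (svalP a).
    + by have := valP a; rewrite in_setC /= e (svalP b).
    + by rewrite (val_inj e).
  - by move=> [a|a] [b|b] //=; rewrite -?gE // edge_sym.
  - by move=> i [a|a]; rewrite in_hprod_block inE.
apply: (embedding_iso gemb).
(* The inverse of [g] needs the membership proof itself to build an element of a subtype, hence the
   match on [boolP]. *)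
pose h z : vert (hprod H (induced B) (induced (~: B))) :=
  match boolP (z \in B) with
  | AltTrue zB => inl (Sub z zB)
  | AltFalse zB => inr (Sub z (introT setCP (elimN idP zB)))
  end.
have gh : cancel h g.
  by move=> z; rewrite /h; case: {-}_ / boolP.
by exists h => //; apply: inj_can_sym gh _; case: gemb.
Qed.

(** * From factorizations to families of vertex sets *)

Definition pieces (d : seq ({set vert T} * pgraph n)) : Prop :=
  List.Forall (fun p => realizes p.1 p.2) d.

Lemma pieces_cat d1 d2 : pieces (d1 ++ d2) <-> pieces d1 /\ pieces d2.
Proof. exact: List.Forall_app. Qed.

Lemma pieces_atomic d :
  pieces d -> List.Forall (h_prime H) (unzip2 d) -> all atomic (unzip1 d).
Proof.
elim: d => [|p d IH] //= dp /List.Forall_cons_iff[pH dH].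
have {dp} [pS dp] := proj1 (List.Forall_cons_iff _ _ _) dp.
by rewrite (prime_atomic pH pS) IH.
Qed.

Lemma pieces_iso d e :
  pieces d -> pieces e -> unzip1 d = unzip1 e ->
  List.Forall2 (@pgraph_iso n) (unzip2 d) (unzip2 e).
Proof.
elim: d e => [|[S G] d IH] [|[U F] e] //= dp ep [SU de].
have {dp} [/= SG dp] := proj1 (List.Forall_cons_iff _ _ _) dp.
have {ep} [/= UF ep] := proj1 (List.Forall_cons_iff _ _ _) ep.
by constructor; [apply: realizes_iso UF; rewrite -SU | apply: IH].
Qed.

(** Products are bracketed to the left, so the induction removes the last factor. The remaining
    product is only embedded in [T], which is why the statement is about embeddings rather than
    isomorphisms. *)
Lemma hprods_pieces G Gs (f : vert (hprods H G Gs) -> vert T) :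
  embedding f ->
  exists d, [/\ unzip2 d = G :: Gs, pieces d, pairwise precedes (unzip1 d)
    & \bigcup_(A <- unzip1 d) A = f @: [set: vert (hprods H G Gs)]].
Proof.
elim/last_ind: Gs f => [|Gs F IH] f.
  move=> femb; exists [:: (f @: setT, G)]; split=> //=.
    by constructor=> //; exists f.
  by rewrite big_seq1.
rewrite /hprods foldl_rcons in f * => femb; have [fI fE fB] := femb.
have femb1 := embedding_comp femb (embedding_inl (hprods H G Gs) F).
have femb2 := embedding_comp femb (embedding_inr (hprods H G Gs) F).
have [d [dG dp dd dT]] := IH _ femb1.
set S := (f \o inr) @: [set: vert F].
exists (rcons d (S, F)); rewrite /unzip1 /unzip2 !map_rcons; split.
- by rewrite -rcons_cons -dG.
- rewrite -cats1; apply/pieces_cat; split=> //.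
  by constructor=> //; exists (f \o inr).
- rewrite pairwise_rcons dd andbT; apply/allP => A Ad.
  have subA x : x \in A -> exists y, x = f (inl y).
    move=> xA; have : x \in \bigcup_(A <- unzip1 d) A.
      by apply/bigcup_seqP; exists A.
    by rewrite dT => /imsetP[y _ ->]; exists y.
  apply/andP; split.
    rewrite disjoint_subset; apply/subsetP => x /subA[y ->].
    by rewrite inE; apply/negP => /imsetP[z _ /fI].
  apply/cutP => x y /subA[a ->] /imsetP[b _ ->].
  by rewrite fE /= (embedding_cross _ _ femb1 femb2).
- rewrite -cats1 big_cat big_seq1 /= dT; apply/setP => x; rewrite inE.
  apply/orP/imsetP => [[] /imsetP[y _ ->]|[[y|y] _ ->]].
  + by exists (inl y).
  + by exists (inr y).
  + by left; apply: imset_f (f \o inl) _ _ _.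
  + by right; apply: imset_f (f \o inr) _ _ _.
Qed.

Lemma iso_hprods_pieces G Gs :
  pgraph_iso T (hprods H G Gs) ->
  exists d, [/\ unzip2 d = G :: Gs, pieces d, pairwise precedes (unzip1 d)
    & \bigcup_(A <- unzip1 d) A = [set: vert T]].
Proof.
move/pgraph_iso_sym/iso_embedding => [f femb [g fK gK]].
have [d [dG dp dd dT]] := hprods_pieces femb; exists d; split=> //.
by rewrite dT; apply/setP => x; rewrite inE -[x]gK imset_f.
Qed.

Lemma hprod_comm S U G F :
  realizes S G -> realizes U F -> cut S U -> cut U S ->
  pgraph_iso (hprod H G F) (hprod H F G).
Proof.
move=> [f femb ->] [g gemb ->] /cutP SU /cutP US.
(* Being cut in both orders, the edges between [S] and [U] are given by [cross] in either direction,
   so [cross] is symmetric between [G] and [F] and exchanging the summands is an isomorphism. *)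
have crossC x y : @cross n H G F x y = cross H y x.
  rewrite -(embedding_cross _ _ femb gemb) -(embedding_cross _ _ gemb femb).
  by rewrite -SU ?imset_f // edge_sym US ?imset_f.
pose h (V W : Type) (u : V + W) : W + V :=
  match u with inl x => inr x | inr y => inl y end.
have hK V W : cancel (@h V W) (@h W V) by case.
apply: (@embedding_iso _ (hprod H G F) (hprod H F G) (@h (vert G) (vert F))); last first.
  by exists (@h (vert F) (vert G)); apply: hK.
split=> [|[x|x] [y|y]|i [x|x]] //=; rewrite ?in_hprod_block //.
exact: can_inj (hK _ _).
Qed.

End Pieces.

(** * Reordering by commuting interchanges *)

Lemma commuting_swaps_cons G s t :
  commuting_swaps H s t -> commuting_swaps H (G :: s) (G :: t).
Proof.
elim=> [_ _ [s1 s2 P Q PQ]|u|u v w _ IHuv _ IHvw].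
- by apply: Relation_Operators.rt_step; apply: (CommutingSwap (G :: s1)).
- exact: Relation_Operators.rt_refl.
- exact: Relation_Operators.rt_trans IHuv IHvw.
Qed.

Lemma commuting_swaps_front G s1 s2 :
  List.Forall (fun F => pgraph_iso (hprod H F G) (hprod H G F)) s1 ->
  commuting_swaps H (s1 ++ G :: s2) (G :: s1 ++ s2).
Proof.
elim: s1 => [|F s1 IH] sG; first exact: Relation_Operators.rt_refl.
have [FG {}/IH/commuting_swaps_cons IH] :=
  proj1 (List.Forall_cons_iff _ _ _) sG.
apply: Relation_Operators.rt_trans (IH F) _.
by apply: Relation_Operators.rt_step; apply: (CommutingSwap [::]).
Qed.

(** Selection sort: the piece at the head of [u] is moved to the front of [d], and the rest is
    sorted by induction. Each factor travels along with its set. *)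
Lemma sort_pieces T (d : seq ({set vert T} * pgraph n)) u :
  pieces d -> pairwise (@cut T) (unzip1 d) -> pairwise (@cut T) u ->
  perm_eq (unzip1 d) u ->
  exists d', [/\ unzip1 d' = u, pieces d'
    & commuting_swaps H (unzip2 d) (unzip2 d')].
Proof.
elim: u d => [|A u IH] d dp dd.
  case: d {dp dd} => [|p d] _ /perm_size //= _; exists [::].
  by split=> //; apply: Relation_Operators.rt_refl.
rewrite /= => /andP[/allP Au uu] du.
have Ad : A \in unzip1 d by rewrite (perm_mem du) mem_head.
case/splitPr def_d: _ / Ad => [s1 s2].
have [d1 [[|[B G] d2] [dE [s1E [//= BA s2E]]]]] :=
  List.map_eq_app _ _ _ _ def_d.
subst d s1 s2 B; rewrite /unzip1 !map_cat /= in dd du.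
have {}du : perm_eq (unzip1 (d1 ++ d2)) u.
  by move: du; rewrite -cat1s perm_catCA perm_cons /unzip1 map_cat.
have [d1p /(List.Forall_cons_iff _ _ _)[/= AG d2p]] :=
  proj1 (pieces_cat _ _) dp.
have d12 : pairwise (@cut T) (unzip1 (d1 ++ d2)).
  move: dd; rewrite /unzip1 map_cat !pairwise_cat allrel_consr /=.
  by case/and3P=> /andP[_ ->] -> /andP[_ ->].
have d12p : pieces (d1 ++ d2) by apply/pieces_cat.
have [d' [d'u d'p swaps]] := IH _ d12p d12 uu du.
exists ((A, G) :: d'); split; rewrite /= ?d'u //; first by constructor.
apply: Relation_Operators.rt_trans (commuting_swaps_cons G swaps).
rewrite /unzip2 !map_cat /=; apply: commuting_swaps_front.
(* A set passed by [A] stands before [A] in [d] and after it in the target order, so the two are cut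
   in both orders and their factors commute. *)
have : {in unzip1 d1, forall B, cut B A && cut A B}.
  move=> B Bd1; rewrite Au ?andbT; last first.
    by rewrite -(perm_mem du) /unzip1 map_cat mem_cat Bd1.
  move: dd; rewrite pairwise_cat allrel_consr => /andP[/andP[/allP]].
  by move=> + _ _; apply.
elim: d1 d1p {dp dd du d12 d12p swaps def_d} => [|[B F] d1 IHd] //= d1p cutA.
have [/= BF {}d1p] := proj1 (List.Forall_cons_iff _ _ _) d1p.
have /andP[BA AB] := cutA B (mem_head _ _).
constructor; first exact: hprod_comm BF AG BA AB.
by apply: IHd => // C Cd; apply: cutA; rewrite inE Cd orbT.
Qed.

End Factorization.

Theorem theorem5 (n : nat) (H : rel 'I_n) (T : pgraph n)
    (T1 : pgraph n) (Ts : seq (pgraph n))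
    (R1 : pgraph n) (Rs : seq (pgraph n)) :
  List.Forall (h_prime H) (T1 :: Ts) ->
  List.Forall (h_prime H) (R1 :: Rs) ->
  pgraph_iso T (hprods H T1 Ts) ->
  pgraph_iso T (hprods H R1 Rs) ->
  size (T1 :: Ts) = size (R1 :: Rs) /\
  exists Ss : seq (pgraph n),
    commuting_swaps H (T1 :: Ts) Ss /\
    List.Forall2 (@pgraph_iso n) Ss (R1 :: Rs).
Proof.
move=> Tprime Rprime /iso_hprods_pieces[d [dE dp dd dT]].
move=> /iso_hprods_pieces[e [eE ep ee eT]].
rewrite -{}dE in Tprime *; rewrite -{}eE in Rprime *.
(* Both factorizations have the same sets as pieces; only the order can differ. *)
have de : perm_eq (unzip1 d) (unzip1 e).
  by apply: (@atomic_perm_eq _ H) => //; apply: pieces_atomic.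
have precW : subrel (@precedes n H T) (@cut n H T) by move=> A B /andP[].
have [d' [d'e d'p swaps]] :=
  sort_pieces dp (sub_pairwise precW dd) (sub_pairwise precW ee) de.
split; first by have := perm_size de; rewrite !size_map.
by exists (unzip2 d'); split=> //; apply: pieces_iso.
Qed.
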